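(* Let $G$ be a triangle-free graph with $\operatorname{diam}(G)=\operatorname{diam}(\overline{G})=3$, where $\overline{G}$ is the complement of $G$. Then $G$ is edge-reconstructible; that is, every graph $H$ with $\mathcal{ED}(H)=\mathcal{ED}(G)$ is isomorphic to $G$.
   Context: All graphs are finite and simple. $\operatorname{diam}(G)=\max_{u,v\in V(G)} d_G(u,v)$, where $d_G(u,v)$ is the length of a shortest path from $u$ to $v$ in $G$ (so a graph of finite diameter is connected). An edge-card of $G$ is a graph $G-e$ with $e\in E(G)$ (the edge is deleted and all vertices are kept), and the edge-deck of $G$ is the multiset $\mathcal{ED}(G)=\{G-e: e\in E(G)\}$, with edge-cards considered up to isomorphism. Thus $\mathcal{ED}(H)=\mathcal{ED}(G)$ means there is a bijection $\psi:E(G)\to E(H)$ with $G-e\cong H-\psi(e)$ for all $e\in E(G)$. *)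

(* Defs.v *)
From mathcomp Require Import all_boot.

Set Implicit Arguments.
Unset Strict Implicit.
Unset Printing Implicit Defensive.

Record sgraph := SGraph {
  vertex :> finType;
  adj : rel vertex;
  adj_sym : symmetric adj;
  adj_irrefl : irreflexive adj
}.

Definition edges (G : sgraph) : {set {set G}} :=
  [set e | [exists x : G, exists y : G, adj x y && (e == [set x; y])]].

Definition triangle_free (G : sgraph) : Prop :=
  forall x y z : G, ~ [/\ adj x y, adj y z & adj z x].

Section Complement.
Variable G : sgraph.

Definition compl_adj (x y : G) : bool := (x != y) && ~~ adj x y.

Lemma compl_adj_sym : symmetric compl_adj.
Proof. by move=> x y; rewrite /compl_adj eq_sym adj_sym. Qed.

Lemma compl_adj_irrefl : irreflexive compl_adj.
Proof. by move=> x; rewrite /compl_adj eqxx. Qed.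

Definition complement : sgraph := SGraph compl_adj_sym compl_adj_irrefl.

End Complement.

Section DeleteEdge.
Variables (G : sgraph) (e : {set G}).

Definition del_adj (x y : G) : bool := adj x y && ([set x; y] != e).

Lemma del_adj_sym : symmetric del_adj.
Proof. by move=> x y; rewrite /del_adj adj_sym setUC. Qed.

Lemma del_adj_irrefl : irreflexive del_adj.
Proof. by move=> x; rewrite /del_adj adj_irrefl. Qed.

Definition del_edge : sgraph := SGraph del_adj_sym del_adj_irrefl.

End DeleteEdge.

Definition has_path (G : sgraph) (u v : G) (n : nat) : bool :=
  [exists p : n.-tuple G,
     [&& path (@adj G) u p, uniq (u :: p) & last u p == v]].

(* A path has fewer than #|G| edges, so searching the lengths below #|G| finds
   the shortest one. The value is #|G| when v is unreachable from u; [diam]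
   only uses distances in connected graphs. *)
Definition dist (G : sgraph) (u v : G) : nat :=
  find (has_path u v) (iota 0 #|G|).

Definition connected (G : sgraph) : bool :=
  [forall u : G, forall v : G, connect (@adj G) u v].

(* [None] is the infinite diameter of a disconnected graph. *)
Definition diam (G : sgraph) : option nat :=
  if connected G then Some (\max_(u : G) \max_(v : G) dist u v) else None.

Lemma has_path_lt (G : sgraph) (u v : G) n : has_path u v n -> n < #|G|.
Proof.
case/existsP=> p /and3P[_ up _].
by rewrite -(size_tuple p) -[(size p).+1]/(size (u :: p)) -(card_uniqP up) max_card.
Qed.

Lemma connect_has_path (G : sgraph) (u v : G) :
  connect (@adj G) u v -> exists n, has_path u v n.
Proof.
case/connectP=> p /shortenP[q qP uq _] ->.
by exists (size q); apply/existsP; exists (in_tuple q); rewrite qP uq eqxx.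
Qed.

Lemma dist_has_path (G : sgraph) (u v : G) :
  connect (@adj G) u v -> has_path u v (dist u v).
Proof.
move=> /connect_has_path[n nP]; rewrite /dist.
have hP : has (has_path u v) (iota 0 #|G|).
  by apply/hasP; exists n; rewrite // mem_iota (has_path_lt nP).
by have := nth_find 0 hP; rewrite nth_iota // -[X in _ < X](size_iota 0) -has_find.
Qed.

Lemma dist_min (G : sgraph) (u v : G) n : has_path u v n -> dist u v <= n.
Proof.
move=> nP; rewrite leqNgt; apply/negP => lt_n.
by have := before_find 0 lt_n; rewrite nth_iota ?(has_path_lt nP) // nP.
Qed.

Definition isomorphic (G H : sgraph) : Prop :=
  exists2 f : G -> H, bijective f & forall x y : G, adj (f x) (f y) = adj x y.

(* Equality of edge-decks as multisets of isomorphism classes. *)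
Definition same_edge_deck (G H : sgraph) : Prop :=
  exists2 psi : {e : {set G} | e \in edges G} -> {e : {set H} | e \in edges H},
    bijective psi
  & forall e, isomorphic (del_edge (val e)) (del_edge (val (psi e))).

Definition edge_reconstructible (G : sgraph) : Prop :=
  forall H : sgraph, same_edge_deck G H -> isomorphic H G.

(* Main.v *)
Require Import Defs.
From mathcomp Require Import all_boot.
From mathcomp Require Import perm.
From mathcomp Require Import zify.

(** Two vertices [u], [v] at distance 3 in the complement of [G] form an edge of
    [G] such that every vertex is adjacent to [u] or to [v]. As [G] has no
    triangle, the neighbourhoods [A] of [u] and [B] of [v] are independent and
    disjoint, so [G] is bipartite with parts [A] (containing [v]) and [B]
    (containing [u]). A pair at distance 3 in [G] must lie in different parts,
    so [G] is not complete bipartite.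

    Choose the names so that [deg v <= deg u], that is, [B] is not the larger
    part, and let [y] have minimum degree in [B] (in the whole graph when the
    parts are equally large). A reconstruction [H] is, up to isomorphism, the
    card [G - yv] plus one edge [pq]. Three restrictions on [pq] determine [H].

    - Every card of [H] is a card of [G], hence bipartite. If [y] is not a leaf,
      an edge [pq] inside a part would close a triangle or a pentagon avoiding
      some other edge of [H], so [pq] joins [A] to [B]
      ([added_edge_across]).
    - The card [G - uv] also lies in [H], and its bipartition is unique as soon
      as some edge avoids both [u] and [v]. Were [y] not in [{p, q}], its degree
      in [H] would be smaller than all the degrees that the card allows there
      ([added_edge_at_min]). So [y] is an end of the new edge, say [q = y].
    - The number of pairs of adjacent edges is edge-reconstructible by Kelly's
      counting argument ([deck_cherries]). Moving the end [v] of an edge to [p]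
      preserves it only if [p] and [v] have the same degree in [G - yv]
      ([moved_end_deg]).

    If [p] is in [A], then in [G - yv] both [p] and [v] are adjacent to all of
    [B] except [y], so exchanging these twins shows that [H] is isomorphic to
    [G]. The vertex [p] can be in [B] only if [y] is a leaf, and then the parts
    of [H] would have sizes [deg u + 1] and [deg v - 1], again contradicting the
    unique bipartition of [G - uv] ([leaf_stays_in_part]). *)

Set Implicit Arguments.
Unset Strict Implicit.
Unset Printing Implicit Defensive.

(** * Edges and degrees *)

Lemma set2_eq (T : finType) (x y s t : T) :
  ([set x; y] == [set s; t]) = (x == s) && (y == t) || (x == t) && (y == s).
Proof.
apply/eqP/idP => [E|/orP[] /andP[/eqP-> /eqP->] //]; last exact: setUC.
have: [/\ x \in [set s; t], y \in [set s; t],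
          s \in [set x; y] & t \in [set x; y]].
  by split; rewrite ?E ?set21 ?set22 // -E ?set21 ?set22.
rewrite !inE (eq_sym s x) (eq_sym s y) (eq_sym t x) (eq_sym t y).
by case: (x == s); case: (x == t); case: (y == s); case: (y == t); case.
Qed.

Definition deg (G : sgraph) (x : G) : nat := #|[set y | adj x y]|.

Lemma mem_edges (G : sgraph) (x y : G) : ([set x; y] \in edges G) = adj x y.
Proof.
rewrite inE; apply/existsP/idP => [[s /existsP[t /andP[st]]]|xy]; last first.
  by exists x; apply/existsP; exists y; rewrite xy eqxx.
by rewrite set2_eq => /orP[] /andP[/eqP-> /eqP->]; rewrite // adj_sym.
Qed.

Lemma edgesP (G : sgraph) (e : {set G}) :
  reflect (exists x y : G, adj x y /\ e = [set x; y]) (e \in edges G).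
Proof.
apply: (iffP idP) => [|[x [y [xy ->]]]]; last by rewrite mem_edges.
rewrite inE => /existsP[x /existsP[y /andP[xy /eqP ->]]].
by exists x, y.
Qed.

Lemma adj_neq (G : sgraph) (x y : G) : adj x y -> x != y.
Proof. by apply: contraTneq => ->; rewrite adj_irrefl. Qed.

Lemma deg_del_edge (G : sgraph) (e : {set G}) (s : G) :
  e \in edges G -> deg s = @deg (del_edge e) s + (s \in e).
Proof.
case/edgesP => x [y [xy ->]]; rewrite /deg.
have nxy := adj_neq xy.
have [|] := boolP (s \in [set x; y]).
- move=> sxy.
  (* The end of the deleted edge other than s. *)
  have [t [st Ee]] : exists t, adj s t /\ [set x; y] = [set s; t].
    move: sxy; rewrite !inE => /orP[] /eqP ->; first by exists y.
    by exists x; rewrite adj_sym setUC.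
  rewrite Ee (cardsD1 t) inE st addnC; congr (_ + _).
  apply: eq_card => w; rewrite !inE /= /del_adj set2_eq eqxx /= andbC.
  congr (_ && _); congr (~~ _).
  by case: (w == t) => //=; rewrite (negPf (adj_neq st)).
- rewrite !inE negb_or => /andP[sx sy]; rewrite addn0.
  apply: eq_card => w; rewrite !inE /= /del_adj set2_eq.
  by rewrite (negPf sx) (negPf sy) andbT.
Qed.

Lemma deg_iso (G H : sgraph) (f : G -> H) (x : G) :
  bijective f -> (forall s t : G, adj (f s) (f t) = adj s t) ->
  deg (f x) = deg x.
Proof.
move=> bf adjf; have injf := bij_inj bf.
rewrite /deg -(card_imset _ injf); apply: eq_card => z.
case: bf => g fK gK; rewrite -(gK z) (mem_imset _ _ injf) !inE; exact: adjf.
Qed.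

(** * The number of pairs of adjacent edges *)

(** Ordered pairs of distinct edges with a common end, counted at that end. *)
Definition cherries (G : sgraph) : nat := \sum_(x : G) deg x * (deg x).-1.

Lemma cherries_iso (G H : sgraph) : isomorphic G H -> cherries G = cherries H.
Proof.
case=> f bf adjf; rewrite /cherries [RHS](reindex f) /=; last exact: onW_bij.
by apply: eq_bigr => x _; rewrite (deg_iso x bf adjf).
Qed.

Lemma cherries_sum (G : sgraph) :
  cherries G = \sum_(x : G) \sum_(y : G) \sum_(z : G | z != y) (adj x y && adj x z).
Proof.
apply: eq_bigr => x _.
have E y : \sum_(z : G | z != y) (adj x y && adj x z) = adj x y * (deg x).-1.
  have [xy|xy] := boolP (adj x y); last by rewrite mul0n big1.
  rewrite /= mul1n /deg (cardsD1 y) inE xy add1n /= -sum1_card.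
  rewrite big_mkcond [RHS]big_mkcond; apply: eq_bigr => z _ /=; rewrite !inE.
  by case: (z != y) => //=; case: (adj x z).
rewrite (eq_bigr _ (fun y _ => E y)) -big_distrl /=; congr (_ * _).
rewrite /deg -sum1_card big_mkcond; apply: eq_bigr => z _ /=; rewrite !inE.
by case: (adj x z).
Qed.

(** Kelly's count: a pair of adjacent edges survives in every card except the two
    that delete one of its edges. *)
Lemma kelly_cherries (G : sgraph) :
  \sum_(e in edges G) cherries (del_edge e) = (#|edges G| - 2) * cherries G.
Proof.
have E (e : {set G}) : cherries (del_edge e) = \sum_(x : G) \sum_(y : G)
    \sum_(z : G | z != y) (del_adj e x y && del_adj e x z) := cherries_sum _.
rewrite (eq_bigr _ (fun e _ => E e)).
rewrite exchange_big cherries_sum big_distrr; apply: eq_bigr => x _.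
rewrite exchange_big big_distrr; apply: eq_bigr => y _.
rewrite exchange_big big_distrr; apply: eq_bigr => z zy /=.
rewrite /del_adj.
have [/andP[xy xz]|] := boolP (adj x y && adj x z); last first.
  rewrite muln0 => no; apply: big1 => e _.
  by case: (adj x y) (adj x z) no => [] [] //=; rewrite andbF.
rewrite xy xz /= muln1.
have ne : [set x; z] != [set x; y].
  by rewrite set2_eq eqxx (negPf zy) /= (negPf (adj_neq xy)).
rewrite (cardsD1 [set x; y]) (cardsD1 [set x; z]) in_setD1 !mem_edges xy xz ne /=.
rewrite addnA addKn -sum1_card big_mkcond [RHS]big_mkcond.
apply: eq_bigr => e _; rewrite !in_setD1 (eq_sym e [set x; y]) (eq_sym e [set x; z]).
by case: (e \in _); case: ([set x; y] == e); case: ([set x; z] == e).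
Qed.

(** * Consequences of equal edge-decks *)

Lemma deck_card (G H : sgraph) : same_edge_deck G H -> #|edges G| = #|edges H|.
Proof. by case=> psi /bij_eq_card; rewrite !card_sig. Qed.

Lemma deck_sub (G H : sgraph) (e : {set G}) :
  same_edge_deck G H -> e \in edges G ->
  exists2 g, g \in edges H & isomorphic (del_edge e) (del_edge g).
Proof.
case=> psi _ iso eG; exists (val (psi (Sub e eG))); first exact: valP.
exact: iso (Sub e eG).
Qed.

Lemma isomorphic_sym (G H : sgraph) : isomorphic G H -> isomorphic H G.
Proof.
case=> f [g fK gK] adjf; exists g; first by exists f.
by move=> x y; rewrite -adjf !gK.
Qed.

Lemma same_edge_deck_sym (G H : sgraph) : same_edge_deck G H -> same_edge_deck H G.
Proof.
case=> psi [phi psiK phiK] iso; exists phi; first by exists psi.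
by move=> e; apply: isomorphic_sym; rewrite -{2}(phiK e).
Qed.

(** With at least three edges, the factor in Kelly's count can be cancelled. *)
Lemma deck_cherries (G H : sgraph) :
  same_edge_deck G H -> 2 < #|edges G| -> cherries G = cherries H.
Proof.
move=> deckGH m2; have mH := deck_card deckGH.
have m0 : 0 < #|edges G| - 2 by rewrite subn_gt0.
apply/eqP; rewrite -(eqn_pmul2l m0) {2}mH -!kelly_cherries.
case: deckGH => psi bpsi iso.
apply/eqP; rewrite [LHS]big_sub [RHS]big_sub (reindex psi (onW_bij _ bpsi)) /=.
by apply: eq_bigr => e _; apply: cherries_iso (iso e).
Qed.

(** This is how two graphs with the same edge-deck are compared: [H] is written, on
    the vertices of [G], as [G] with [xy] replaced by [pq]. The fourth item says
    that [pq] is new in [G - xy]; the last one compares the degrees on both sides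
    of the common card without subtraction. *)
Lemma edge_replacement (G H : sgraph) (x y : G) :
  same_edge_deck G H -> adj x y ->
  exists (f : G -> H) (p q : G),
  [/\ bijective f, p != q,
      forall s t : G, adj (f s) (f t) =
        adj s t && ([set s; t] != [set x; y]) || ([set s; t] == [set p; q]),
      adj p q -> [set p; q] = [set x; y]
    & forall s : G, deg (f s) + (s \in [set x; y]) = deg s + (s \in [set p; q])].
Proof.
move=> deckGH xy; have xyE : [set x; y] \in edges G by rewrite mem_edges.
have [g gE [f bf adjf]] := deck_sub deckGH xyE.
have [f' fK f'K] := bf.
have injf : injective (f : G -> H) := can_inj fK.
have [p' [q' [pq gpq]]] := edgesP _ gE.
exists f, (f' p'), (f' q').
have gf : g = [set f (f' p'); f (f' q')] by rewrite gpq !f'K.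
move: (f' p') (f' q') gf => p q gf {gpq p' q' pq}.
have pq : @adj H (f p) (f q) by rewrite -mem_edges -gf.
have st_g (s t : G) : ([set f s; f t] == g) = ([set s; t] == [set p; q]).
  by rewrite gf !set2_eq !(inj_eq injf).
have adjf' (s t : G) : @adj H (f s) (f t) && ([set s; t] != [set p; q]) =
    adj s t && ([set s; t] != [set x; y]).
  by rewrite -st_g; exact: adjf.
split=> //.
- by apply: contraTneq pq => ->; rewrite adj_irrefl.
- move=> s t; rewrite -adjf'; have [|] := boolP ([set s; t] == [set p; q]).
    by rewrite set2_eq andbF => /orP[] /andP[/eqP-> /eqP->]; rewrite // adj_sym.
  by rewrite andbT orbF.
- move=> pqG; apply/eqP; have := adjf' p q.
  by rewrite eqxx andbF pqG /= => /esym/negbFE.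
- move=> s; rewrite (deg_del_edge _ gE) (deg_del_edge s xyE).
  have -> : (f s \in g) = (s \in [set p; q]) by rewrite gf !inE !(inj_eq injf).
  by rewrite (@deg_iso (del_edge _) (del_edge _) f s bf adjf) addnAC.
Qed.

Definition bicoloring (G : sgraph) (c : G -> bool) : Prop :=
  forall x y : G, adj x y -> c x != c y.

Lemma card_bicoloring (G H : sgraph) (c : G -> bool) (g : {set H}) :
  same_edge_deck G H -> bicoloring c -> g \in edges H ->
  exists d : del_edge g -> bool, bicoloring d.
Proof.
move=> /same_edge_deck_sym deckHG cP gE.
have [e eE [f bf adjf]] := deck_sub deckHG gE.
exists (fun x => c (f x)) => x y; rewrite -adjf => /andP[xy _]; exact: cP.
Qed.

(** Only the degrees of [v] and [p] change when [yv] is replaced by [yp], so the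
    numbers of cherries agree only if these two degrees are exchanged. *)
Lemma moved_end_deg (G H : sgraph) (f : G -> H) (y v p : G) :
  bijective f -> cherries G = cherries H -> v != p -> y != v -> y != p ->
  0 < deg v ->
  (forall s : G, deg (f s) + (s \in [set y; v]) = deg s + (s \in [set y; p])) ->
  deg v = (deg p).+1.
Proof.
move=> bf ch vp yv yp v0 degf.
have chH : cherries H = \sum_(s : G) deg (f s) * (deg (f s)).-1.
  by rewrite /cherries (reindex f (onW_bij _ bf)).
move: ch; rewrite chH /cherries.
rewrite (bigD1 v) // (bigD1 p) /=; last by rewrite eq_sym.
rewrite [RHS](bigD1 v) // [in RHS](bigD1 p) /=; last by rewrite eq_sym.
rewrite [X in _ + (_ + X) = _](eq_bigr (fun s => deg (f s) * (deg (f s)).-1)).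
  move: (degf v) (degf p); rewrite !inE !eqxx (negPf vp) (eq_sym v y) (negPf yv).
  rewrite (eq_sym p y) (negPf yp) (eq_sym p v) (negPf vp) /=.
  case: (deg v) v0 => // n _; case: (deg p) => [|k] /=; nia.
move=> s /andP[sv sp]; move: (degf s); rewrite !inE (negPf sv) (negPf sp) !orbF.
by move/addIn => ->.
Qed.

(** In [G - yv] the vertices [p] and [v] have the same neighbours, so it does not
    matter to which of them [y] is joined. *)
Lemma twin_swap (G H : sgraph) (f : G -> H) (y v p : G) :
  bijective f -> y != p ->
  (forall s t : G, adj (f s) (f t) =
     adj s t && ([set s; t] != [set y; v]) || ([set s; t] == [set y; p])) ->
  adj v y ->
  (forall t : G, adj p t = adj v t && (t != y)) ->
  isomorphic H G.
Proof.
move=> bf yp adjf vy Np; apply: isomorphic_sym.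
have vyN : v != y := adj_neq vy.
exists (fun s => f (tperm v p s)).
  apply: bij_comp => //; exists (tperm v p); exact: tpermK.
have vp : v != p by apply: contraTneq vy => ->; rewrite Np eqxx andbF.
have Np' t : adj t p = adj t v && (t != y) by rewrite adj_sym Np adj_sym.
move=> s t; rewrite adjf !set2_eq.
case: (tpermP v p s) => [->|->|/eqP/negPf sv /eqP/negPf sp];
  case: (tpermP v p t) => [->|->|/eqP/negPf tv /eqP/negPf tp];
  rewrite ?Np ?Np' ?adj_irrefl ?eqxx ?sv ?sp ?tv ?tp ?(negPf vyN) ?(eq_sym y);
  rewrite ?(eq_sym p) ?(negPf yp) ?(negPf vp) ?(negPf vyN) /=;
  rewrite ?andbF ?andbT ?orbF //.
- by case: eqP => [->|_]; rewrite ?vy ?andbT ?orbF.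
- by case: eqP => [->|_]; rewrite ?(adj_sym y) ?vy ?andbT ?orbF.
Qed.

(** * Triangle-free graphs with a dominating edge *)

Definition dominating_edge (G : sgraph) (u v : G) : Prop :=
  adj u v /\ forall z : G, adj u z || adj v z.

Lemma dominating_edge_sym (G : sgraph) (u v : G) :
  dominating_edge u v -> dominating_edge v u.
Proof. by case=> uv dom; split=> [|z]; [rewrite adj_sym | rewrite orbC]. Qed.

Lemma dominating_edge_compl (G : sgraph) (u v z : G) :
  triangle_free G -> dominating_edge u v -> adj v z = ~~ adj u z.
Proof.
move=> tf [uv dom]; have := dom z; have [uz|//] := boolP (adj u z).
by move=> _; apply/negP => vz; case: (tf u v z); rewrite uv vz adj_sym.
Qed.

Lemma dominating_edge_bicoloring (G : sgraph) (u v : G) :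
  triangle_free G -> dominating_edge u v -> bicoloring (@adj G u).
Proof.
move=> tf dom s t st; have vE z := dominating_edge_compl z tf dom.
apply/eqP; have [us|nus] := boolP (adj u s) => /esym ut.
  by case: (tf u s t); rewrite us st adj_sym ut.
by case: (tf v s t); rewrite vE nus st adj_sym vE ut.
Qed.

(** The graph without [uv] is still connected: the stars at [u] and at [v] are
    linked by [xy]. So a proper colouring is determined by the colour of [v], even
    if it is only required to be proper away from the dominating edge. *)
Lemma bicoloring_without_dominating_edge
    (G : sgraph) (u v x y : G) (d : G -> bool) :
  triangle_free G -> dominating_edge u v ->
  adj u x -> x != v -> adj v y -> y != u -> adj x y ->
  (forall s t : G, adj s t -> [set s; t] != [set u; v] -> d s != d t) ->
  forall z : G, d z = (adj u z == d v).
Proof.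
move=> tf dom ux xv vy yu xy dP; have [uv _] := dom.
have vE z := dominating_edge_compl z tf dom.
have dA z : adj u z -> z != v -> d u != d z.
  move=> uz zv; apply: dP => //.
  by rewrite set2_eq eqxx (negPf zv) (negPf (adj_neq uv)).
have dB z : adj v z -> z != u -> d v != d z.
  move=> vz zu; apply: dP => //; rewrite set2_eq eqxx (negPf zu) andbF.
  by rewrite eq_sym (negPf (adj_neq uv)).
have duv : d u != d v.
  have dxy : d x != d y.
    apply: dP => //; rewrite set2_eq (negPf xv) (negPf yu) andbF orbF.
    by rewrite eq_sym (negPf (adj_neq ux)).
  move: (dA _ ux xv) (dB _ vy yu) dxy.
  by case: (d u) (d v) (d x) (d y) => [] [] [] [].
move=> z; have [uz|nuz] := boolP (adj u z).
  have [->|zv] := eqVneq z v; first by case: (d v).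
  by move: (dA _ uz zv) duv; case: (d u) (d v) (d z) => [] [] [].
have [->|zu] := eqVneq z u; first by move: duv; case: (d u) (d v) => [] [].
have vz : adj v z by rewrite vE.
by move: (dB _ vz zu) duv; case: (d u) (d v) (d z) => [] [] [].
Qed.

(** * Where the new edge can be *)

(** An added edge inside a part closes an odd cycle. With both ends in [A] this is
    a triangle through [u]; with both ends in [B] it is a triangle through [v],
    unless the edge contains [y], which has just lost its edge to [v]. In that case
    the other neighbour [x] of [y] gives the triangle [y u x] or a pentagon through
    [x], [u] and [v]. Each time an explicit edge ([yx] or [uz]) is off the cycle,
    and deleting it leaves a card of [H] that is not bipartite. *)
Lemma added_edge_across (G H : sgraph) (u v x y z p q : G) (f : G -> H) :
  triangle_free G -> dominating_edge u v -> same_edge_deck G H ->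
  adj v y -> adj y x -> x != v -> adj u z -> ~~ adj y z ->
  bijective f -> p != q ->
  (forall s t : G, adj (f s) (f t) =
     adj s t && ([set s; t] != [set y; v]) || ([set s; t] == [set p; q])) ->
  adj u p != adj u q.
Proof.
move=> tf dom deckGH vy yx xv uz yz bf pq adjf; have [uv _] := dom.
have vE w := dominating_edge_compl w tf dom.
have uP := dominating_edge_bicoloring tf dom.
have injf := bij_inj bf.
have yu : y != u by apply: contraNneq yz => ->.
have nuy : ~~ adj u y by rewrite -vE.
have ux : adj u x by move: (uP _ _ yx); rewrite (negPf nuy); case: (adj u x).
have zv : z != v by apply: contraNneq yz => ->; rewrite adj_sym.
have zx : z != x by apply: contraNneq yz => ->.
have xu : x != u by rewrite eq_sym (adj_neq ux).
have vu : v != u by rewrite eq_sym (adj_neq uv).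
have xy : x != y by rewrite eq_sym (adj_neq yx).
have yv : y != v by rewrite eq_sym (adj_neq vy).
have zy : z != y by apply: contraTneq uz => ->.
have [uy ux' vy'] : [/\ u != y, u != x & v != y] by split; rewrite eq_sym.
have [vz xz yz'] : [/\ v != z, x != z & y != z] by split; rewrite eq_sym.
have vu_adj : adj v u by rewrite adj_sym.
have xu_adj : adj x u by rewrite adj_sym.
(* Every card of H is bipartite, since it is a card of G. *)
have cut s t : adj (f s) (f t) -> exists d : G -> bool, forall s' t',
    adj (f s') (f t') -> [set s'; t'] != [set s; t] -> d s' != d t'.
  move=> st; have st' : [set f s; f t] \in edges H by rewrite mem_edges.
  have [d dP] := card_bicoloring deckGH uP st'.
  exists (fun w => d (f w)) => s' t' st1 ne; apply: dP.
  by rewrite /= /del_adj st1 set2_eq !(inj_eq injf) -set2_eq.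
have keep s t : adj s t -> s != y -> t != y -> adj (f s) (f t).
  by move=> st sy ty; rewrite adjf st set2_eq (negPf sy) (negPf ty) andbF.
have fyx : adj (f y) (f x) by rewrite adjf yx set2_eq eqxx (negPf xv) (negPf yv).
have fpq : adj (f p) (f q) by rewrite adjf eqxx orbT.
have fuz : adj (f u) (f z) by apply: keep; rewrite // eq_sym.
have ne a b s t : a != s -> a != t -> [set a; b] != [set s; t].
  by move=> /negPf as_ /negPf at_; rewrite set2_eq as_ at_.
have fC a b : adj (f a) (f b) -> adj (f b) (f a) by rewrite adj_sym.
have pentagon w : w != y -> w != u -> adj v w -> ~ adj (f y) (f w).
  move=> wy wu vw fyw.
  have [d dP] := cut _ _ fuz.
  have d1 : d y != d w by apply: dP; rewrite ?ne // ?keep //.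
  have d2 : d v != d w by apply: dP; rewrite ?ne // ?keep //.
  have d3 : d v != d u by apply: dP; rewrite ?ne // ?keep //.
  have d4 : d x != d u by apply: dP; rewrite ?ne // ?keep //.
  have d5 : d y != d x by apply: dP; rewrite ?ne //.
  move: d1 d2 d3 d4 d5.
  by case: (d y) (d w) (d v) (d u) (d x) => [] [] [] [] [].
have triangle : ~ adj (f y) (f u).
  move=> fyu; have [d dP] := cut _ _ fuz.
  have d1 : d y != d u by apply: dP; rewrite ?ne // ?keep //.
  have d2 : d x != d u by apply: dP; rewrite ?ne // ?keep //.
  have d3 : d y != d x by apply: dP; rewrite ?ne //.
  by move: d1 d2 d3; case: (d y) (d u) (d x) => [] [] [].
apply/eqP; have [up|nup] := boolP (adj u p) => /esym uq.
- have [d dP] := cut _ _ fyx.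
  have py : p != y by apply: contraTneq up => ->.
  have qy : q != y by apply: contraTneq uq => ->; rewrite (negPf nuy).
  have d1 : d u != d p by apply: dP; rewrite ?ne // ?keep //.
  have d2 : d u != d q by apply: dP; rewrite ?ne // ?keep //.
  have d3 : d p != d q.
    by apply: dP; rewrite // set2_eq (negPf py) (negPf qy) andbF.
  by move: d1 d2 d3; case: (d u) (d p) (d q) => [] [] [].
have vp : adj v p by rewrite vE.
have vq : adj v q by rewrite vE uq.
have [py|py] := eqVneq p y.
  have [qu|qu] := eqVneq q u; first by apply: triangle; rewrite -qu -py.
  by apply: (pentagon q) => //; [rewrite -py eq_sym | rewrite -py].
have [qy|qy] := eqVneq q y.
  have [pu|pu] := eqVneq p u; first by apply: triangle; rewrite -pu -qy fC.
  by apply: (pentagon p) => //; rewrite -qy fC.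
have [d dP] := cut _ _ fuz.
have pz : p != z by apply: contraTneq vp => ->; rewrite vE uz.
have qz : q != z by apply: contraTneq vq => ->; rewrite vE uz.
have d1 : d v != d p by apply: dP; rewrite ?ne // ?keep //.
have d2 : d v != d q by apply: dP; rewrite ?ne // ?keep //.
have d3 : d p != d q.
  by apply: dP; rewrite // set2_eq (negPf pz) (negPf qz) andbF.
by move: d1 d2 d3; case: (d v) (d p) (d q) => [] [] [].
Qed.

Lemma deg_lt_nonadj (G : sgraph) (x y : G) :
  deg x < deg y -> exists2 z, adj y z & ~~ adj x z.
Proof.
move=> lt; have : ~~ ([set z | adj y z] \subset [set z | adj x z]).
  by apply: contraL lt => /subset_leq_card; rewrite -leqNgt.
by case/subsetPn => z; rewrite !inE => yz xz; exists z.
Qed.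

Lemma deg_gt1 (G : sgraph) (x y z : G) : adj x y -> adj x z -> y != z -> 1 < deg x.
Proof.
by move=> xy xz yz; rewrite /deg (cardsD1 y) (cardsD1 z) !inE xy xz eq_sym yz.
Qed.

(** If the new edge misses [y], then [y] has degree [deg y - 1] in [H]. Let [z] be
    the vertex in the place of [y] in the copy of [G - uv] inside [H]. When [y] is
    not a leaf, that copy determines the parts of [H], so [z] is in [B], or the
    parts are equally large; either way [deg y <= deg z], and the loss of [uv]
    does no harm because [deg y < deg u]. When [y] is a leaf it is enough that
    [G - uv] has no isolated vertex. *)
Lemma added_edge_at_min (G H : sgraph) (u v y p q : G) (f : G -> H) :
  triangle_free G -> dominating_edge u v -> same_edge_deck G H ->
  adj v y -> deg y < deg u -> 1 < deg v ->
  (forall z : G, adj v z -> deg y <= deg z) -> deg v <= deg u ->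
  (deg u = deg v -> forall z : G, deg y <= deg z) ->
  bijective f ->
  (forall s t : G, adj (f s) (f t) =
     adj s t && ([set s; t] != [set y; v]) || ([set s; t] == [set p; q])) ->
  (forall s : G, deg (f s) + (s \in [set y; v]) = deg s + (s \in [set p; q])) ->
  ((exists2 x, adj y x & x != v) -> adj u p != adj u q) ->
  y \in [set p; q].
Proof.
move=> tf dom deckGH vy ltyu v2 minB levu minall bf adjf degf across.
have [uv _] := dom; have vE w := dominating_edge_compl w tf dom.
apply/negPn/negP => ynpq.
have degy : (deg (f y)).+1 = deg y.
  by have := degf y; rewrite set21 (negPf ynpq) addn0 addn1.
(* Delete uv instead of yv: h embeds G - uv in the same graph H. *)
have [h [p' [q' [bh _ adjh _ degh]]]] := edge_replacement deckGH uv.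
have [h' hK h'K] := bh; pose z := h' (f y).
have hz : h z = f y by rewrite /z h'K.
have ledegz : deg z <= deg (f y) + (z \in [set u; v]).
  by rewrite -hz degh leq_addr.
have zu : z != u.
  apply/eqP => zu; move: ledegz; rewrite zu set21 addn1 degy leqNgt.
  by rewrite ltyu.
have zv : z = v -> deg v <= deg y.
  by move=> zv; move: ledegz; rewrite zv set22 addn1 degy.
have degz : z != v -> deg z < deg y.
  by move=> zv'; move: ledegz; rewrite !inE (negPf zu) (negPf zv') addn0 -degy.
have [/existsP[x /andP[yx xv]]|nox] := boolP [exists x : G, adj y x && (x != v)].
- have {}across : adj u p != adj u q by apply: across; exists x.
  have uP := dominating_edge_bicoloring tf dom.
  have [f' fK f'K] := bf.
  have fP s t : adj (f s) (f t) -> adj u s != adj u t.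
    rewrite adjf => /orP[/andP[st _]|]; first exact: uP.
    by rewrite set2_eq => /orP[] /andP[/eqP-> /eqP->]; rewrite // eq_sym.
  have hP s t : adj s t -> [set s; t] != [set u; v] ->
      adj u (f' (h s)) != adj u (f' (h t)).
    by move=> st ne; apply: fP; rewrite !f'K adjh st ne.
  have yu : y != u by apply: contraTneq ltyu => ->; rewrite ltnn.
  have nuy : ~~ adj u y by rewrite -vE.
  have ux : adj u x by move: (uP _ _ yx); rewrite (negPf nuy); case: (adj u x).
  have xy : adj x y by rewrite adj_sym.
  have dE := bicoloring_without_dominating_edge tf dom ux xv vy yu xy hP.
  have := dE z; rewrite hz fK (negPf nuy).
  move: dE; case: (adj u (f' (h v))) => dE; case uz: (adj u z) => // _.
    have vz : adj v z by rewrite vE uz.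
    have zv' : z != v by rewrite eq_sym (adj_neq vz).
    by move: (degz zv'); rewrite ltnNge minB.
  (* The copy of G - uv puts A in the place of B, so they are equally large. *)
  have eqdeg : deg u = deg v.
    rewrite /deg -(card_preimset _ (_ : injective (fun s => f' (h s)))).
      by apply: eq_card => s; rewrite !inE dE vE; case: (adj u s).
    by apply: inj_comp; [exact: (can_inj f'K) | exact: (bij_inj bh)].
  have [zv'|zv'] := eqVneq z v; last by move: (degz zv'); rewrite ltnNge minall.
  by move: ltyu; rewrite eqdeg ltnNge zv.
- have degy1 : deg y = 1.
    rewrite /deg -(cards1 v); apply: eq_card => t; rewrite !inE.
    apply/idP/eqP => [yt|->]; last by rewrite adj_sym.
    by apply/eqP; apply: contraNT nox => tv; apply/existsP; exists t; rewrite yt.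
  have [zv'|zv'] := eqVneq z v; first by move: v2; rewrite ltnNge -degy1 zv.
  have := degz zv'; rewrite degy1 ltnNge => /negP; apply.
  rewrite /deg; apply/card_gt0P.
  by have [_ /(_ z)/orP[]] := dom; [exists u | exists v]; rewrite inE adj_sym.
Qed.

(** If [p] were in [B], moving [y] to the other part would make [H] bipartite with
    [deg u + 1] vertices in one part. The degree of [p] forces an edge from [p] to
    some [x] other than [v], so the copy of [G - uv] in [H] allows only parts of
    sizes [deg u] and [deg v]. *)
Lemma leaf_stays_in_part (G H : sgraph) (u v y p : G) (f : G -> H) :
  triangle_free G -> dominating_edge u v -> same_edge_deck G H ->
  adj v y -> (forall t, adj y t -> t = v) -> deg v <= deg u ->
  y != u -> y != p -> deg v = (deg p).+1 -> bijective f ->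
  (forall s t : G, adj (f s) (f t) =
     adj s t && ([set s; t] != [set y; v]) || ([set s; t] == [set y; p])) ->
  adj u p.
Proof.
move=> tf dom deckGH vy leafy levu yu yp degvp bf adjf.
have [uv _] := dom; have vE w := dominating_edge_compl w tf dom.
have uP := dominating_edge_bicoloring tf dom.
have nuy : ~~ adj u y by rewrite -vE.
apply/negPn/negP => nup; have vp : adj v p by rewrite vE.
have vu : adj v u by rewrite adj_sym.
have pu : p != u.
  by apply: contraTneq levu => pu; rewrite -ltnNge degvp pu.
have [x px xv] : exists2 x, adj p x & x != v.
  have : 1 < deg p.
    rewrite -ltnS -degvp /deg (cardsD1 u) (cardsD1 y) (cardsD1 p) !inE vu vy vp.
    by rewrite yu pu eq_sym yp.
  rewrite /deg (cardsD1 v) inE adj_sym vp ltnS card_gt0 => /set0Pn[x].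
  by rewrite !inE => /andP[xv px]; exists x.
have xp : adj x p by rewrite adj_sym.
have ux : adj u x by move: (uP _ _ px); rewrite (negPf nup); case: (adj u x).
have [f' fK f'K] := bf.
(* The parts of H: the leaf y has moved to the side of A. *)
pose c s := adj u s || (s == y).
have cP s t : adj (f s) (f t) -> c s != c t.
  have cyp : c y != c p by rewrite /c eqxx orbT (negPf nup) (eq_sym p) (negPf yp).
  rewrite adjf => /orP[/andP[st]|]; last first.
    by rewrite set2_eq => /orP[] /andP[/eqP-> /eqP->]; rewrite // eq_sym.
  rewrite /c; have [sy|_] := eqVneq s y.
    by move: st; rewrite sy => /leafy ->; rewrite eqxx.
  have [ty|_] := eqVneq t y; last by rewrite !orbF uP.
  by move: st; rewrite ty adj_sym => /leafy ->; rewrite setUC eqxx.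
have [h [p' [q' [bh _ adjh _ _]]]] := edge_replacement deckGH uv.
have hP s t : adj s t -> [set s; t] != [set u; v] ->
    c (f' (h s)) != c (f' (h t)).
  by move=> st ne; apply: cP; rewrite !f'K adjh st ne.
have dE := bicoloring_without_dominating_edge tf dom ux xv vp pu xp hP.
have cardc : #|[set s | c s]| = (deg u).+1.
  rewrite (cardsD1 y) inE /c eqxx orbT add1n; congr _.+1.
  apply: eq_card => s; rewrite !inE; have [->|_] := eqVneq s y; last by rewrite orbF.
  by rewrite (negPf nuy).
have : #|[set s | c s]| <= deg u.
  rewrite -(card_preimset _ (_ : injective (fun s => f' (h s)))); last first.
    by apply: inj_comp; [exact: (can_inj f'K) | exact: (bij_inj bh)].
  case: (c (f' (h v))) dE => dE; last apply: leq_trans levu;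
    apply: subset_leq_card; apply/subsetP => s; rewrite !inE dE ?vE;
    by case: (adj u s).
by rewrite cardc ltnn.
Qed.

(** * Reconstruction *)

(** Here [deg u] and [deg v] are the sizes of the parts, and [y] is a vertex of
    minimum degree in the smaller part. With parts of equal size a card cannot tell
    them apart, so [y] must then be minimal in the whole graph. *)
Lemma reconstruct_by_min_deg (G : sgraph) (u v y : G) :
  triangle_free G -> dominating_edge u v ->
  adj v y -> deg y < deg u ->
  (forall z : G, adj v z -> deg y <= deg z) -> deg v <= deg u ->
  (deg u = deg v -> forall z : G, deg y <= deg z) ->
  edge_reconstructible G.
Proof.
move=> tf dom vy ltyu minB levu minall H deckGH.
have [uv _] := dom; have vE w := dominating_edge_compl w tf dom.
have uP := dominating_edge_bicoloring tf dom.
have nuy : ~~ adj u y by rewrite -vE.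
have yu : y != u by apply: contraTneq ltyu => ->; rewrite ltnn.
have yv : y != v by rewrite eq_sym (adj_neq vy).
have vu : adj v u by rewrite adj_sym.
have yv_adj : adj y v by rewrite adj_sym.
have [z uz yz] := deg_lt_nonadj ltyu.
have zv : z != v by apply: contraNneq yz => ->.
have v2 : 1 < deg v by apply: (deg_gt1 vu vy); rewrite eq_sym.
(* The edges uv, uz and vy are distinct. *)
have m3 : 2 < #|edges G|.
  rewrite (cardsD1 [set u; v]) (cardsD1 [set u; z]) (cardsD1 [set v; y]).
  rewrite !in_setD1 !mem_edges uv uz vy !set2_eq !eqxx (negPf zv) (eq_sym v u).
  by rewrite (negPf (adj_neq uv)) (negPf yu) (eq_sym v z) (negPf zv) /= ?andbF.
have ch := deck_cherries deckGH m3.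
have [f [p0 [q0 [bf pq0 adjf newf degf]]]] := edge_replacement deckGH yv_adj.
have across : (exists2 x, adj y x & x != v) -> adj u p0 != adj u q0.
  case=> x yx xv.
  exact: (added_edge_across tf dom deckGH vy yx xv uz yz bf pq0 adjf).
have [p [Epq yp newp acrossp]] : exists p, [/\ [set p0; q0] = [set y; p], y != p,
    adj y p -> [set p0; q0] = [set y; v]
  & (exists2 x, adj y x & x != v) -> adj u p].
  have := added_edge_at_min tf dom deckGH vy ltyu v2 minB levu minall bf adjf
    degf across.
  rewrite !inE => /orP[] /eqP yE; [subst p0; exists q0 | subst q0; exists p0].
    by split=> // /across; rewrite (negPf nuy); case: (adj u q0).
  split; [exact: setUC | by rewrite eq_sym | by rewrite adj_sym |].
  by move=> /across; rewrite (negPf nuy); case: (adj u p0).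
move: adjf newp degf; rewrite Epq => adjf newp degf {across newf Epq pq0}.
(* If the deleted edge is put back, H is G itself. *)
have [pv|pv] := eqVneq p v.
  apply: isomorphic_sym; exists f => // s t; rewrite adjf pv.
  by case: eqP => [E|_]; rewrite ?andbT ?orbF // -mem_edges E mem_edges yv_adj.
have degvp : deg v = (deg p).+1.
  have vp : v != p by rewrite eq_sym.
  exact: (moved_end_deg bf ch vp yv yp (ltnW v2) degf).
have up : adj u p.
  have [/existsP[x /andP[yx xv]]|nox] := boolP [exists x : G, adj y x && (x != v)].
    by apply: acrossp; exists x.
  apply: (leaf_stays_in_part tf dom deckGH vy _ levu yu yp degvp bf adjf) => t yt.
  by apply/eqP; apply: contraNT nox => tv; apply/existsP; exists t; rewrite yt.
have nyp : ~~ adj y p.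
  apply/negP => /newp /eqP; rewrite set2_eq eqxx (negPf pv) /=.
  by rewrite (negPf yv).
(* The inclusion holds by bipartiteness, and the two sets have the same size. *)
have Np : [set t | adj p t] = [set t | adj v t] :\ y.
  apply/eqP; rewrite eqEcard; apply/andP; split; last first.
    have := cardsD1 y [set t | adj v t]; rewrite inE vy.
    by move: degvp; rewrite /deg => -> [->].
  apply/subsetP => t; rewrite !inE => pt.
  have ty : t != y by apply: contraNneq nyp => <-; rewrite adj_sym.
  by rewrite ty vE; move: (uP _ _ pt); rewrite up; case: (adj u t).
apply: (twin_swap bf yp adjf vy) => t.
by have /setP/(_ t) := Np; rewrite !inE andbC.
Qed.

(** The neighbours of [t] are neighbours of [u], and [s] is missing. *)
Lemma deg_lt_dominating (G : sgraph) (u v s t : G) :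
  triangle_free G -> dominating_edge u v ->
  adj v t -> adj u s -> ~~ adj s t -> deg t < deg u.
Proof.
move=> tf dom vt us nst; apply: proper_card; apply/properP; split.
  apply/subsetP => w; rewrite !inE => tw.
  have := dominating_edge_bicoloring tf dom tw.
  by move: vt; rewrite (dominating_edge_compl t tf dom) => /negPf ->; case: (adj u w).
by exists s; rewrite !inE // adj_sym.
Qed.

Lemma reconstruct_unequal_parts (G : sgraph) (u v s t : G) :
  triangle_free G -> dominating_edge u v ->
  adj v t -> adj u s -> ~~ adj s t -> deg v < deg u ->
  edge_reconstructible G.
Proof.
move=> tf dom vt us nst lt.
have [y vy ymin] := arg_minnP (@deg G) vt.
apply: (@reconstruct_by_min_deg G u v y) => //; last by move=> E; rewrite E ltnn in lt.
  exact: leq_ltn_trans (ymin _ vt) (deg_lt_dominating tf dom vt us nst).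
exact: ltnW.
Qed.

Lemma dominating_edge_reconstructible (G : sgraph) (u v s t : G) :
  triangle_free G -> dominating_edge u v ->
  adj v t -> adj u s -> ~~ adj s t -> edge_reconstructible G.
Proof.
move=> tf dom vt us nst; have dom' := dominating_edge_sym dom.
have nts : ~~ adj t s by rewrite adj_sym.
have ltu := deg_lt_dominating tf dom vt us nst.
have ltv := deg_lt_dominating tf dom' us vt nts.
have [lt|lt|E] := ltngtP (deg v) (deg u).
- exact: (reconstruct_unequal_parts tf dom vt us nst).
- exact: (reconstruct_unequal_parts tf dom' us vt nts).
have [y _ ymin] := arg_minnP (@deg G) (erefl (xpredT t)).
have [_ /(_ y)/orP[uy|vy]] := dom.
- apply: (reconstruct_by_min_deg tf dom' uy) => [|w _||_ w]; rewrite ?E ?ymin //.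
  by apply: leq_ltn_trans (ymin s isT) _; rewrite -E.
- apply: (reconstruct_by_min_deg tf dom vy) => [|w _||_ w]; rewrite ?E ?ymin //.
  exact: leq_ltn_trans (ymin t isT) _.
Qed.

(** * Diameter three *)

Lemma diam_attained (G : sgraph) (d : nat) :
  diam G = Some d.+1 -> exists u v : G, dist u v = d.+1.
Proof.
rewrite /diam; case: ifP => // _ [maxd].
have Gpos : 0 < #|G|.
  rewrite lt0n; apply: contra_eq_neq maxd => G0; rewrite big_pred0 // => u.
  by have := fintype0 u G0.
have [u maxu] := eq_bigmax (fun u : G => \max_(v : G) dist u v) Gpos.
have [v maxv] := eq_bigmax (fun v : G => dist u v) Gpos.
by exists u, v; rewrite -maxv -maxu.
Qed.

Lemma dist_gt2 (G : sgraph) (u v : G) : 2 < dist u v ->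
  [/\ u != v, ~~ adj u v & forall w, ~~ (adj u w && adj w v)].
Proof.
move=> far; have short n : has_path u v n -> 2 < n.
  by move=> /dist_min; apply: leq_trans.
have uv : u != v.
  apply/eqP => uv; suff /short : has_path u v 0 by [].
  by apply/existsP; exists [tuple]; rewrite /= uv eqxx.
have nuv : ~~ adj u v.
  apply/negP => a; suff /short : has_path u v 1 by [].
  by apply/existsP; exists [tuple v]; rewrite /= a inE uv eqxx.
split=> // w; apply/negP => /andP[uw wv]; suff /short : has_path u v 2 by [].
apply/existsP; exists [tuple w; v].
by rewrite /= uw wv !inE negb_or (adj_neq uw) uv (adj_neq wv) eqxx.
Qed.

Theorem theorem1p8 (G : sgraph) (G_triangle_free : triangle_free G)
    (diam_G : diam G = Some 3) (diam_complement_G : diam (complement G) = Some 3) :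
  edge_reconstructible G.
Proof.
have [u [v duv]] : exists u v : G, @dist (complement G) u v = 3 :=
  diam_attained diam_complement_G.
have [s [t dst]] := diam_attained diam_G.
have [uv nuv nw] := @dist_gt2 (complement G) u v (eq_leq (esym duv)).
have [st nst ns] : [/\ s != t, ~~ adj s t & forall w, ~~ (adj s w && adj w t)].
  by apply: dist_gt2; rewrite dst.
have {nuv} auv : @adj G u v by move: nuv; rewrite /= /compl_adj uv negbK.
have dom : @dominating_edge G u v.
  split=> // w; have := nw w; rewrite /= /compl_adj (adj_sym w).
  have [<-|uw] := eqVneq u w; first by rewrite (adj_sym v u) auv orbT.
  have [->|wv] := eqVneq w v; first by rewrite auv.
  by rewrite /= -negb_or negbK.
have across w : adj w s -> adj w t -> False.
  by move=> ws wt; have := ns w; rewrite adj_sym ws wt.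
have [_ domw] := dom.
case/orP: (domw s) => [us|vs]; case/orP: (domw t) => [ut|vt].
- by case: (across u).
- exact: (dominating_edge_reconstructible G_triangle_free dom vt us nst).
- apply: (dominating_edge_reconstructible G_triangle_free dom vs ut).
  by rewrite adj_sym.
- by case: (across v).
Qed.
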